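(* Let $\mathcal G$ be a connected graph with $n\ge 2$ nodes and $m$ lines with positive line weights, and consider the linear stochastic power system described in the context, with its matrices $\mathbf L,\mathbf M,\mathbf D,\widetilde{\mathbf B},\widetilde{\mathbf C},\mathbf U,\widehat{\mathbf U}$, the eigenvalues $\lambda_1,\dots,\lambda_n$, the solution $\mathbf Q_x$ of the Lyapunov equation, and the asymptotic output variance $\mathbf Q_y$. Decompose $$\mathbf{Q}_x=\begin{bmatrix}\mathbf{G}&\mathbf{S}\\ \mathbf{S}^{\top}&\mathbf{R}\end{bmatrix},$$ where $\mathbf G=(g_{i,j})=\mathbf G^\top\in\mathbb R^{(n-1)\times(n-1)}$, $\mathbf S=(s_{i,j})\in\mathbb R^{(n-1)\times n}$ and $\mathbf R=(r_{i,j})=\mathbf R^\top\in\mathbb R^{n\times n}$. Then the blocks of $\mathbf{Q}_y=\begin{bmatrix}\mathbf{Q}_\delta& \mathbf{Q}_{\delta\omega}^{\top}\\ \mathbf{Q}_{\delta\omega}&\mathbf{Q}_\omega\end{bmatrix}$ (with $\mathbf Q_\delta\in\mathbb R^{m\times m}$, $\mathbf Q_{\delta\omega}\in\mathbb R^{n\times m}$, $\mathbf Q_\omega\in\mathbb R^{n\times n}$) satisfy $$\mathbf{Q}_\delta=\widetilde{\mathbf{C}}^\top\mathbf{M}^{-1/2}\widehat{\mathbf{U}}\mathbf{G}\widehat{\mathbf{U}}^{\top}\mathbf{M}^{-1/2}\widetilde{\mathbf{C}},\quad \mathbf{Q}_\omega=\mathbf{M}^{-1/2}\mathbf{U}\mathbf{R}\mathbf{U}^{\top}\mathbf{M}^{-1/2},\quad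 \mathbf{Q}_{\delta\omega}=\mathbf{M}^{-1/2}\mathbf{U}\mathbf{S}^{\top}\widehat{\mathbf{U}}^{\top}\mathbf{M}^{-1/2}\widetilde{\mathbf{C}}.$$ Moreover, suppose there is $\alpha>0$ with $d_i/m_i=\alpha$ for all nodes $i$, and put $$\rho_i=2\alpha^2+\lambda_i,\qquad \chi_{i,j}=(\lambda_i-\lambda_j)^2+2\alpha^2(\lambda_i+\lambda_j).$$ Then the entries of $\mathbf S,\mathbf G,\mathbf R$ are given explicitly as follows, where $\widetilde{\mathbf B}^2=\widetilde{\mathbf B}\widetilde{\mathbf B}^\top$: (a) for $i=1,\dots,n-1$: $s_{i,1}=\rho_{i+1}^{-1}\,\mathbf{u}_{i+1}^{\top}\mathbf{M}^{-1/2}\widetilde{\mathbf{B}}^2\mathbf{M}^{-1/2}\mathbf{u}_{1}$; (b) for $i,j=2,\dots,n$: $s_{i-1,j}=\dfrac{\lambda_{i}-\lambda_{j}}{\chi_{i,j}}\,\mathbf{u}_{i}^{\top}\mathbf{M}^{-1/2}\widetilde{\mathbf{B}}^2\mathbf{M}^{-1/2}\mathbf{u}_{j}$; (c) for $i,j=2,\dots,n$: $g_{i-1,j-1}=\dfrac{2\alpha}{\chi_{i,j}}\,\mathbf{u}_{i}^{\top}\mathbf{M}^{-1/2}\widetilde{\mathbf{B}}^2\mathbf{M}^{-1/2}\mathbf{u}_{j}$; (d) $r_{1,1}=\dfrac{1}{2\alpha}\,\mathbf{u}_{1}^{\top}\mathbf{M}^{-1/2}\widetilde{\mathbf{B}}^2\mathbf{M}^{-1/2}\mathbf{u}_{1}$;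 (e) for $i,j=1,\dots,n$ with $(i,j)\ne(1,1)$: $r_{i,j}=\dfrac{\alpha(\lambda_{i}+\lambda_{j})}{\chi_{i,j}}\,\mathbf{u}_{i}^{\top}\mathbf{M}^{-1/2}\widetilde{\mathbf{B}}^2\mathbf{M}^{-1/2}\mathbf{u}_{j}$.
   Context: Let $\mathcal G=(\mathcal V,\mathcal E)$ be a connected undirected graph with nodes $\mathcal V=\{1,\dots,n\}$ and lines $e_1,\dots,e_m$. Each line $(i,j)$ has weight $w_{i,j}=w_{j,i}=K_{i,j}\cos(\delta_i^*-\delta_j^* )>0$ (line capacity times cosine of the synchronous phase difference, which is less than $\pi/2$ in absolute value; only the positive numbers $w_{i,j}$ matter here), and $w_{i,j}=0$ if $(i,j)\notin\mathcal E$. $\mathbf L$ is the weighted Laplacian: $l_{i,j}=-w_{i,j}$ for $i\ne j$ and $l_{i,i}=\sum_{k\neq i}w_{i,k}$. $\widetilde{\mathbf C}=(c_{i,k})\in\mathbb R^{n\times m}$ is the incidence matrix for an arbitrary orientation of the lines: $c_{i,k}=1$ if node $i$ is the beginning of $e_k$, $-1$ if it is the end, $0$ otherwise. $\mathbf M=\mathrm{diag}(m_i)$ with $m_i>0$ (inertia), $\mathbf D=\mathrm{diag}(d_i)$ with $d_i>0$ (damping), $\widetilde{\mathbf B}=\mathrm{diag}(b_i)$ with $b_i>0$ (disturbance strength). The stochastic system is $$\mathrm d\boldsymbol\delta=\boldsymbol\omega\,\mathrm dt,\qquad \mathrm d\boldsymbol\omega=-\mathbf M^{-1}(\mathbf L\boldsymbol\delta+\mathbf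 D\boldsymbol\omega)\,\mathrm dt+\mathbf M^{-1}\widetilde{\mathbf B}\,\mathrm d\mathbf v(t),$$ with $\mathbf v$ a standard $n$-dimensional Brownian motion, and with output $\mathbf y=(\mathbf y_\delta,\mathbf y_\omega)=(\widetilde{\mathbf C}^\top\boldsymbol\delta,\boldsymbol\omega)\in\mathbb R^{m+n}$ (phase differences in the lines and frequencies at the nodes). Let $\mathbf U=[\mathbf u_1\ \mathbf u_2\cdots\mathbf u_n]$ be an orthogonal matrix with $\mathbf U^\top\mathbf M^{-1/2}\mathbf L\mathbf M^{-1/2}\mathbf U=\mathbf\Lambda_n=\mathrm{diag}(\lambda_1,\dots,\lambda_n)$, $0=\lambda_1<\lambda_2\le\cdots\le\lambda_n$; put $\widehat{\mathbf U}=[\mathbf u_2\cdots\mathbf u_n]$ and $\mathbf\Lambda_{n-1}=\mathrm{diag}(\lambda_2,\dots,\lambda_n)$. Define $$\mathbf A_2=\begin{bmatrix}\mathbf 0&\mathbf A_{22}\\ \mathbf A_{23}&-\mathbf U^\top\mathbf M^{-1}\mathbf D\mathbf U\end{bmatrix}\in\mathbb R^{(2n-1)\times(2n-1)},\quad \mathbf A_{22}=[\mathbf 0\ \ \mathbf I_{n-1}]\in\mathbb R^{(n-1)\times n},\quad \mathbf A_{23}^\top=[\mathbf 0\ \ -\mathbf\Lambda_{n-1}]\in\mathbb R^{(n-1)\times n},$$ $$\mathbf B_2=\begin{bmatrix}\mathbf 0\\ \mathbf U^\top\mathbf M^{-1/2}\widetilde{\mathbf B}\end{bmatrix}\in\mathbb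 R^{(2n-1)\times n},\qquad \mathbf C_2=\begin{bmatrix}\widetilde{\mathbf C}^\top\mathbf M^{-1/2}\widehat{\mathbf U}&\mathbf 0\\ \mathbf 0&\mathbf M^{-1/2}\mathbf U\end{bmatrix}\in\mathbb R^{(m+n)\times(2n-1)}.$$ $\mathbf Q_x$ is the unique solution of $\mathbf A_2\mathbf Q_x+\mathbf Q_x\mathbf A_2^\top+\mathbf B_2\mathbf B_2^\top=\mathbf 0$. The asymptotic variance of the output (the variance of $\mathbf y$ in the invariant probability distribution, $\lim_{t\to\infty}\mathrm{Cov}(\mathbf y(t))$) is $\mathbf Q_y=\mathbf C_2\mathbf Q_x\mathbf C_2^\top$; this may be taken as its definition. *)

(* Defs.v *)
From HB Require Import structures.
From mathcomp Require Import all_boot all_order all_algebra.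

Set Implicit Arguments.
Unset Strict Implicit.
Unset Printing Implicit Defensive.

Import Order.TTheory GRing.Theory Num.Theory.
Local Open Scope ring_scope.

(* Conventions.  The number of nodes is n = 1 + p, so that n - 1 = p and      *)
(* 2n - 1 = p + (1 + p), and node / eigenvalue number 1 of the mathematical   *)
(* text is ord0 : 'I_(1 + p), while number i + 2 is rshift 1 i for i : 'I_p.  *)
(* The diagonals of M, D, B~ and Lambda_n are row vectors 'rV_(1 + p).        *)

Section Graph.

Variables (R : rcfType) (n m : nat).

Definition simple_connected_graph (e : rel 'I_n) : Prop :=
  [/\ symmetric e, irreflexive e & forall i j, connect e i j].

Definition line_weights (e : rel 'I_n) (w : 'M[R]_n) : Prop :=
  [/\ forall i j, w i j = w j i,
      forall i j, e i j -> 0 < w i j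
    & forall i j, ~~ e i j -> w i j = 0].

(* Each undirected line of the graph is listed exactly once, with the         *)
(* arbitrary orientation src k -> tgt k.                                      *)
Definition oriented_lines (e : rel 'I_n) (src tgt : 'I_m -> 'I_n) : Prop :=
  (forall k, e (src k) (tgt k)) /\
  (forall i j, e i j -> exists! k,
     (src k = i /\ tgt k = j) \/ (src k = j /\ tgt k = i)).

Definition laplacian (w : 'M[R]_n) : 'M[R]_n :=
  \matrix_(i, j) (if i == j then \sum_(k | k != i) w i k else - w i j).

Definition incidence (src tgt : 'I_m -> 'I_n) : 'M[R]_(n, m) :=
  \matrix_(i, k) (if i == src k then 1 else if i == tgt k then -1 else 0).

(* diag(x_i)^(-1/2), for positive x_i *)
Definition diag_invsqrt (x : 'rV[R]_n) : 'M[R]_n :=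
  diag_mx (map_mx (fun t => (Num.sqrt t)^-1) x).

End Graph.

Section System.

Variables (R : rcfType) (p m : nat).
Implicit Types (mass d b lam : 'rV[R]_(1 + p)) (U : 'M[R]_(1 + p)).
Implicit Types (Ct : 'M[R]_(1 + p, m)).

Definition spectral_data mass (L : 'M[R]_(1 + p)) U lam : Prop :=
  [/\ U^T *m U = 1%:M,
      U^T *m diag_invsqrt mass *m L *m diag_invsqrt mass *m U = diag_mx lam,
      lam 0 ord0 = 0,
      forall i : 'I_(1 + p), i != ord0 -> 0 < lam 0 i
    & forall i j : 'I_(1 + p), (i <= j)%N -> lam 0 i <= lam 0 j].

Definition Uhat U : 'M[R]_(1 + p, p) := rsubmx U.

Definition Lambda1 lam : 'M[R]_p := diag_mx (rsubmx lam).

Definition A22 : 'M[R]_(p, 1 + p) := row_mx 0 1%:M.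

Definition A23 lam : 'M[R]_(1 + p, p) := (row_mx 0 (- Lambda1 lam))^T.

Definition A2 mass d U lam : 'M[R]_(p + (1 + p)) :=
  block_mx 0 A22
           (A23 lam) (- (U^T *m invmx (diag_mx mass) *m diag_mx d *m U)).

Definition B2 mass b U : 'M[R]_(p + (1 + p), 1 + p) :=
  col_mx 0 (U^T *m diag_invsqrt mass *m diag_mx b).

Definition C2 mass U Ct : 'M[R]_(m + (1 + p), p + (1 + p)) :=
  block_mx (Ct^T *m diag_invsqrt mass *m Uhat U) 0
           0 (diag_invsqrt mass *m U).

Definition lyapunov_solution q r (A : 'M[R]_q) (B : 'M[R]_(q, r))
    (Q : 'M[R]_q) : Prop :=
  A *m Q + Q *m A^T + B *m B^T = 0.

Definition output_variance mass U Ct (Qx : 'M[R]_(p + (1 + p))) :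
    'M[R]_(m + (1 + p)) :=
  C2 mass U Ct *m Qx *m (C2 mass U Ct)^T.

(* u_i^T M^(-1/2) B~^2 M^(-1/2) u_j, with B~^2 = B~ B~^T *)
Definition noise_form mass b U (i j : 'I_(1 + p)) : R :=
  ((col i U)^T *m diag_invsqrt mass *m (diag_mx b *m (diag_mx b)^T)
     *m diag_invsqrt mass *m col j U) 0 0.

Definition rho (alpha : R) lam (i : 'I_(1 + p)) : R :=
  2 * alpha ^+ 2 + lam 0 i.

Definition chi (alpha : R) lam (i j : 'I_(1 + p)) : R :=
  (lam 0 i - lam 0 j) ^+ 2 + 2 * alpha ^+ 2 * (lam 0 i + lam 0 j).

End System.

(* Main.v *)
Require Import Defs.
From HB Require Import structures.
From mathcomp Require Import all_boot all_order all_algebra.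
From mathcomp Require Import ring lra.

Set Implicit Arguments.
Unset Strict Implicit.
Unset Printing Implicit Defensive.

Import Order.TTheory GRing.Theory Num.Theory.
Local Open Scope ring_scope.

(** The Lyapunov equation determines [Qx]: with the energy weight
    [P = diag(Lambda_{n-1}, I)], [P A2] is a skew matrix minus the positive
    definite damping on the frequency block, so a skew solution of the
    homogeneous equation has vanishing frequency rows, hence vanishes since
    [Lambda_{n-1}] is invertible.  Applied to [Qx - Qx^T] this gives the symmetry
    of [Qx].  When [d_i / m_i = alpha] the damping block is [alpha I] and the
    block equations decouple entrywise: off the first index,
    [2 alpha s_ij = (lambda_i - lambda_j) g_ij] and
    [2 r_ij = (lambda_i + lambda_j) g_ij], so the last equation becomes
    [chi_ij g_ij = 2 alpha f_ij] with [f] the noise form. *)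

(** * Diagonal forms, congruences, and dissipation in a Lyapunov equation *)

Section Lyapunov.

Variable R : rcfType.

Lemma invmx_diag n (x : 'rV[R]_n) : (forall i, x 0 i != 0) ->
  invmx (diag_mx x) = diag_mx (map_mx GRing.inv x).
Proof.
move=> x_neq0.
have xVx : diag_mx x *m diag_mx (map_mx GRing.inv x) = 1%:M.
  rewrite mulmx_diag -diag_const_mx; congr diag_mx.
  by apply/rowP => i; rewrite !mxE mulfV.
have [x_unit _] := mulmx1_unit xVx.
by rewrite -[RHS]mul1mx -(mulVmx x_unit) -mulmxA xVx mulmx1.
Qed.

Lemma quad_form_diag q n (x : 'rV[R]_n) (V : 'M[R]_(n, q)) (z : 'cV[R]_q) :
  (z^T *m (V^T *m diag_mx x *m V) *m z) 0 0
    = \sum_i x 0 i * (V *m z) i 0 ^+ 2.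
Proof.
rewrite [z^T *m _ *m z](_ : _ = (V *m z)^T *m diag_mx x *m (V *m z)); last first.
  by rewrite trmx_mul !mulmxA.
rewrite mul_mx_diag mxE; apply: eq_bigr => i _.
by rewrite !mxE; ring.
Qed.

Lemma congruence_mxE n q (N : 'M[R]_n) (V : 'M[R]_(n, q)) i j :
  (V^T *m N *m V) i j = ((col i V)^T *m N *m col j V) 0 0.
Proof.
rewrite !mxE; apply: eq_bigr => k _; rewrite !mxE; congr (_ * _).
by apply: eq_bigr => l _; rewrite !mxE.
Qed.

(* With [P := diag_mx v], transposition and skewness of [X] turn the trace of
   [X^T P (A X + X A^T) P] into twice that of [X^T P A X P], which is a positive
   combination of the values of the quadratic form [P A] on the columns of
   [X]. *)
Lemma skew_lyapunov_dissipation0 q (A X : 'M[R]_q) (v : 'rV[R]_q) :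
    (forall k, 0 < v 0 k) ->
    (forall x : 'cV[R]_q, (x^T *m (diag_mx v *m A) *m x) 0 0 <= 0) ->
    X^T = - X -> A *m X + X *m A^T = 0 ->
  forall k, ((col k X)^T *m (diag_mx v *m A) *m col k X) 0 0 = 0.
Proof.
move=> v_gt0 PA_le0 X_skew lyapX.
set P := diag_mx v in PA_le0 *.
have trP : P^T = P by rewrite tr_diag_mx.
have tr0 : \tr (X^T *m (P *m A) *m X *m P) = 0.
  have : \tr (X^T *m P *m (A *m X + X *m A^T) *m P) = 0.
    by rewrite lyapX mulmx0 mul0mx mxtrace0.
  rewrite mulmxDr mulmxDl mxtraceD.
  have -> : \tr (X^T *m P *m (X *m A^T) *m P) = \tr (X^T *m (P *m A) *m X *m P).
    rewrite -mxtrace_tr !trmx_mul !trmxK trP X_skew.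
    rewrite !(mulmxN, mulNmx) !raddfN /=; congr (- _).
    by rewrite -!mulmxA [RHS]mxtrace_mulC !mulmxA.
  by rewrite !mulmxA => ?; lra.
have colE k := congruence_mxE (P *m A) X k k.
(* The summands are negated so that they are nonnegative: a vanishing sum then forces each of them
   to vanish. *)
have trE : \sum_k - ((X^T *m (P *m A) *m X) k k * v 0 k) = 0.
  apply/eqP; rewrite sumrN oppr_eq0; apply/eqP; rewrite -[RHS]tr0 mul_mx_diag.
  by apply: eq_bigr => k _; rewrite [RHS]mxE.
move=> k.
move/eqP: trE; rewrite psumr_eq0 => [|i _]; last first.
  by rewrite oppr_ge0 colE pmulr_lle0.
move=> /allP /(_ k (mem_index_enum k)) /=.
by rewrite oppr_eq0 mulf_eq0 (gt_eqF (v_gt0 k)) orbF colE => /eqP.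
Qed.

End Lyapunov.

(** * Block products for the power system *)

Section PowerSystem.

Variables (R : rcfType) (p : nat).
Variables (mass d b lam : 'rV[R]_(1 + p)) (U : 'M[R]_(1 + p)).

Let ord0E : ord0 = lshift p ord0 :> 'I_(1 + p).
Proof. exact: val_inj. Qed.

Lemma A22_mulE q (X : 'M[R]_(1 + p, q)) i j :
  (A22 R p *m X) i j = X (rshift 1 i) j.
Proof. by rewrite /A22 -[X]vsubmxK mul_row_col mul0mx add0r mul1mx col_mxEd. Qed.

Lemma mul_trA22E q (X : 'M[R]_(q, 1 + p)) i j :
  (X *m (A22 R p)^T) i j = X i (rshift 1 j).
Proof. by rewrite -[X]trmxK -trmx_mul mxE A22_mulE !mxE. Qed.

Lemma A23E : A23 lam = col_mx 0 (- Lambda1 lam).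
Proof. by rewrite /A23 tr_row_mx trmx0 raddfN /= tr_diag_mx. Qed.

(** The zero mode feels no restoring force, so the first index is treated apart from the others. *)
Lemma A23_mulE0 q (X : 'M[R]_(p, q)) j : (A23 lam *m X) ord0 j = 0.
Proof. by rewrite A23E mul_col_mx mul0mx ord0E col_mxEu mxE. Qed.

Lemma A23_mulE q (X : 'M[R]_(p, q)) i j :
  (A23 lam *m X) (rshift 1 i) j = - (lam 0 (rshift 1 i) * X i j).
Proof.
by rewrite A23E mul_col_mx col_mxEd mulNmx mul_diag_mx !mxE.
Qed.

Lemma mul_trA23E0 q (X : 'M[R]_(q, p)) i : (X *m (A23 lam)^T) i ord0 = 0.
Proof. by rewrite -[X]trmxK -trmx_mul mxE A23_mulE0. Qed.

Lemma mul_trA23E q (X : 'M[R]_(q, p)) i j :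
  (X *m (A23 lam)^T) i (rshift 1 j) = - (lam 0 (rshift 1 j) * X i j).
Proof. by rewrite -[X]trmxK -trmx_mul mxE A23_mulE !mxE. Qed.

Definition damping : 'M[R]_(1 + p) :=
  U^T *m invmx (diag_mx mass) *m diag_mx d *m U.

Definition noise : 'M[R]_(1 + p) :=
  (U^T *m diag_invsqrt mass *m diag_mx b) *m
  (U^T *m diag_invsqrt mass *m diag_mx b)^T.

Lemma tr_noise : noise^T = noise.
Proof. by rewrite /noise trmx_mul trmxK. Qed.

Lemma noiseE i j : noise i j = noise_form mass b U i j.
Proof.
have -> : noise = U^T *m (diag_invsqrt mass *m (diag_mx b *m (diag_mx b)^T)
     *m diag_invsqrt mass) *m U.
  by rewrite /noise !trmx_mul trmxK !tr_diag_mx !mulmxA.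
by rewrite congruence_mxE /noise_form !mulmxA.
Qed.

Section Blocks.

Variables (G : 'M[R]_p) (S : 'M[R]_(p, 1 + p)).
Variables (T : 'M[R]_(1 + p, p)) (Q : 'M[R]_(1 + p)).

(** [T] is not tied to [S], so that the formula serves both the skew difference and the symmetric
    [Qx]. *)
Lemma A2_mul_add_block :
  A2 mass d U lam *m block_mx G S T Q + block_mx G S T Q *m (A2 mass d U lam)^T
  = block_mx (A22 R p *m T + S *m (A22 R p)^T)
      (A22 R p *m Q + (G *m (A23 lam)^T - S *m damping^T))
      (A23 lam *m G - damping *m T + Q *m (A22 R p)^T)
      (A23 lam *m S - damping *m Q + (T *m (A23 lam)^T - Q *m damping^T)).
Proof.
rewrite /A2 -/damping tr_block_mx !mulmx_block add_block_mx !trmx0.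
by rewrite !mul0mx !mulmx0 !add0r raddfN /= !mulmxN !mulNmx.
Qed.

End Blocks.

Lemma B2_mul_tr : B2 mass b U *m (B2 mass b U)^T = block_mx 0 0 0 noise.
Proof.
by rewrite /B2 tr_col_mx mul_col_row trmx0 !mul0mx !mulmx0.
Qed.

(** * Energy dissipation and the symmetry of [Qx] *)

Hypotheses (mass_gt0 : forall i, 0 < mass 0 i) (d_gt0 : forall i, 0 < d 0 i).
Hypothesis UTU : U^T *m U = 1%:M.
Hypothesis lam_gt0 : forall i : 'I_(1 + p), i != ord0 -> 0 < lam 0 i.

Let lam_rshift_gt0 (i : 'I_p) : 0 < lam 0 (rshift 1 i).
Proof. exact: lam_gt0. Qed.

Lemma dampingE : damping = U^T *m diag_mx (\row_i (d 0 i / mass 0 i)) *m U.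
Proof.
rewrite /damping invmx_diag => [|i]; last by rewrite gt_eqF.
rewrite -(mulmxA U^T) mulmx_diag; congr (_ *m diag_mx _ *m _).
by apply/rowP => i; rewrite !mxE mulrC.
Qed.

(* The energy [y^T Lambda_{n-1} y + z^T z] is dissipated by damping only. *)
Lemma energy_dissipation (y : 'cV[R]_p) (z : 'cV[R]_(1 + p)) :
  ((col_mx y z)^T *m
     (diag_mx (row_mx (rsubmx lam) (const_mx 1)) *m A2 mass d U lam)
     *m col_mx y z) 0 0
  = - \sum_i d 0 i / mass 0 i * (U *m z) i 0 ^+ 2.
Proof.
rewrite diag_mx_row diag_const_mx /A2 -/damping mulmx_block tr_col_mx.
rewrite !mul0mx !mul1mx mulmx0 !addr0 !add0r mul_row_block mul_row_col.
rewrite mulmx0 add0r mulmxDl.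
(* The weight [Lambda1 lam] on the phase block makes the couplings through [A22] and [A23] opposite,
   so they cancel in the quadratic form. *)
have -> : y^T *m (diag_mx (rsubmx lam) *m A22 R p) *m z
    = - (z^T *m A23 lam *m y)^T.
  rewrite !trmx_mul trmxK mulmxA.
  rewrite /A23 trmxK /A22 mul_mx_row mulmx0 mulmx1.
  rewrite -mulmxN -mulNmx opp_row_mx oppr0 opprK.
  by rewrite mulmxA mul_mx_row mulmx0.
have -> : \sum_i d 0 i / mass 0 i * (U *m z) i 0 ^+ 2
    = (z^T *m damping *m z) 0 0.
  by rewrite dampingE quad_form_diag; apply: eq_bigr => i _; rewrite [in RHS]mxE.
rewrite mulmxN mulNmx; move: (z^T *m damping *m z) (z^T *m _ *m y) => e c.
by rewrite !mxE addrA subrr add0r.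
Qed.

Lemma skew_lyapunov_A2_eq0 (X : 'M[R]_(p + (1 + p))) : X^T = - X ->
  A2 mass d U lam *m X + X *m (A2 mass d U lam)^T = 0 -> X = 0.
Proof.
move=> X_skew lyapX.
pose v := row_mx (rsubmx lam) (const_mx 1) : 'rV[R]_(p + (1 + p)).
have v_gt0 k : 0 < v 0 k.
  by case: (split_ordP k) => l ->; rewrite /v ?row_mxEl ?row_mxEr mxE ?ltr01.
have term_ge0 (z : 'cV[R]_(1 + p)) i :
    0 <= d 0 i / mass 0 i * (U *m z) i 0 ^+ 2.
  by rewrite mulr_ge0 ?sqr_ge0 // ltW // divr_gt0.
have PA_le0 (x : 'cV[R]_(p + (1 + p))) :
    (x^T *m (diag_mx v *m A2 mass d U lam) *m x) 0 0 <= 0.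
  by rewrite -[x]vsubmxK energy_dissipation oppr_le0 sumr_ge0.
(* Zero dissipation along each column of [X] gives [U *m z = 0] for its frequency part [z], since
   all [d_i / m_i] are positive; [U^T *m U = 1] then gives [z = 0]. *)
have dX0 : dsubmx X = 0.
  apply/matrixP => i k; rewrite [RHS]mxE.
  have -> : dsubmx X i k = (U^T *m (U *m col k (dsubmx X))) i 0.
    by rewrite mulmxA UTU mul1mx [RHS]mxE.
  rewrite (_ : U *m _ = 0) ?mulmx0 ?mxE //; apply/colP => j; rewrite [RHS]mxE.
  have := skew_lyapunov_dissipation0 v_gt0 PA_le0 X_skew lyapX k.
  rewrite -[in col k X](vsubmxK X) col_col_mx energy_dissipation => /eqP.
  rewrite oppr_eq0 psumr_eq0 // => /allP/(_ j (mem_index_enum j)) /=.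
  by rewrite mulf_eq0 sqrf_eq0 gt_eqF ?divr_gt0 //= => /eqP.
have dl0 : dlsubmx X = 0 by rewrite /dlsubmx dX0 raddf0.
have dr0 : drsubmx X = 0 by rewrite /drsubmx dX0 raddf0.
have ur0 : ursubmx X = 0.
  apply: trmx_inj; rewrite trmx_ursub X_skew trmx0 /dlsubmx.
  by rewrite raddfN /= dX0 oppr0 raddf0.
move: lyapX; rewrite -[X]submxK A2_mul_add_block -block_mx0.
(* The lower left block equation is now [A23 lam] times the phase block equal to 0, with nonzero
   factors [lam] on the rows after the first. *)
move=> /eq_block_mx[_ _ + _]; rewrite dl0 dr0 ur0.
rewrite mulmx0 mul0mx subr0 addr0 => /matrixP lamG.
congr block_mx; apply/matrixP => i j.
have := lamG (rshift 1 i) j; rewrite A23_mulE !mxE => /eqP.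
by rewrite oppr_eq0 mulf_eq0 gt_eqF //= => /eqP.
Qed.

(** Transposing the equation swaps its first two terms and fixes the noise term, so [Qx^T] is a
    solution too and the noise cancels in the difference. *)
Lemma lyapunov_A2_sym (Qx : 'M[R]_(p + (1 + p))) :
  lyapunov_solution (A2 mass d U lam) (B2 mass b U) Qx -> Qx^T = Qx.
Proof.
rewrite /lyapunov_solution => lyap.
apply/eqP; rewrite -subr_eq0; apply/eqP/skew_lyapunov_A2_eq0.
  by rewrite raddfB /= trmxK opprB.
have lyapT := congr1 trmx lyap.
rewrite !raddfD /= !trmx_mul !trmxK trmx0 in lyapT.
rewrite addrC in lyapT; rewrite addrC in lyap.
rewrite mulmxBr mulmxBl addrACA -opprD -(addr0_eq lyap).
by rewrite [A2 _ _ _ _ *m Qx^T + _]addrC -(addr0_eq lyapT) subrr.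
Qed.


(** * Uniform damping ratio: explicit entries *)

Lemma damping_uniform alpha : (forall i, d 0 i / mass 0 i = alpha) ->
  damping = alpha%:M.
Proof.
move=> dE; rewrite dampingE (_ : \row_i _ = const_mx alpha).
  by rewrite diag_const_mx mul_mx_scalar -scalemxAl UTU scalemx1.
by apply/rowP => i; rewrite !mxE dE.
Qed.

Hypothesis lam0 : lam 0 ord0 = 0.

Lemma lyapunov_A2_uniform alpha (G : 'M[R]_p) (S : 'M[R]_(p, 1 + p))
    (Q : 'M[R]_(1 + p)) :
    0 < alpha -> (forall i, d 0 i / mass 0 i = alpha) ->
    G^T = G -> Q^T = Q ->
    lyapunov_solution (A2 mass d U lam) (B2 mass b U) (block_mx G S S^T Q) ->
  [/\ forall i : 'I_p,
        S i ord0 = (rho alpha lam (rshift 1 i))^-1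
                   * noise_form mass b U (rshift 1 i) ord0,
      forall i j : 'I_p,
        S i (rshift 1 j) =
          (lam 0 (rshift 1 i) - lam 0 (rshift 1 j))
            / chi alpha lam (rshift 1 i) (rshift 1 j)
          * noise_form mass b U (rshift 1 i) (rshift 1 j),
      forall i j : 'I_p,
        G i j = 2 * alpha / chi alpha lam (rshift 1 i) (rshift 1 j)
                * noise_form mass b U (rshift 1 i) (rshift 1 j),
      Q ord0 ord0 = 1 / (2 * alpha) * noise_form mass b U ord0 ord0
    & forall i j : 'I_(1 + p), (i, j) <> (ord0, ord0) ->
        Q i j = alpha * (lam 0 i + lam 0 j) / chi alpha lam i j
                 * noise_form mass b U i j].
Proof.
move=> alpha_gt0 dE GT QT.
rewrite /lyapunov_solution A2_mul_add_block B2_mul_tr (damping_uniform dE).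
rewrite add_block_mx !addr0 -block_mx0 tr_scalar_mx !mul_mx_scalar !mul_scalar_mx.
move=> /eq_block_mx[/matrixP e11 /matrixP e12 _ /matrixP e22].
have GC i j : G j i = G i j by rewrite -[in LHS]GT mxE.
have QC i j : Q j i = Q i j by rewrite -[in LHS]QT mxE.
(* Restricted forms of [mxE], which would also expand the products with [A22] and [A23] into
   sums. *)
have mxZ m n (M : 'M[R]_(m, n)) i j : (alpha *: M) i j = alpha * M i j.
  by rewrite mxE.
have mxD m n (M N : 'M[R]_(m, n)) i j : (M + N) i j = M i j + N i j.
  by rewrite mxE.
have mxN m n (M : 'M[R]_(m, n)) i j : (- M) i j = - M i j by rewrite mxE.
have mx0E m n i j : (0 : 'M[R]_(m, n)) i j = 0 by rewrite mxE.
pose mxDE := (mxD, mxN, mxZ, mx0E).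
(* Upper left block equation: [S] without its first column is skew. *)
have SC i j : S j (rshift 1 i) = - S i (rshift 1 j).
  by apply/eqP; rewrite -addr_eq0; move: (e11 i j);
    rewrite mxD A22_mulE mul_trA22E !mxE => ->.
have Qi0 i : Q (rshift 1 i) ord0 = alpha * S i ord0.
  by move: (e12 i ord0); rewrite !mxDE A22_mulE mul_trA23E0 => ?; lra.
have Qij i j : Q (rshift 1 i) (rshift 1 j)
    = lam 0 (rshift 1 j) * G i j + alpha * S i (rshift 1 j).
  by move: (e12 i (rshift 1 j)); rewrite !mxDE A22_mulE mul_trA23E => ?; lra.
have F00 : noise_form mass b U ord0 ord0 = 2 * alpha * Q ord0 ord0.
  move: (e22 ord0 ord0); rewrite !mxDE A23_mulE0 mul_trA23E0 noiseE => e00.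
  by lra.
(* With [Q_i1 = alpha s_i1], the two damping terms add [2 alpha^2] to the stiffness [lambda_i],
   which is [rho]. *)
have Fi0 i : noise_form mass b U (rshift 1 i) ord0
    = rho alpha lam (rshift 1 i) * S i ord0.
  move: (e22 (rshift 1 i) ord0).
  rewrite !mxDE A23_mulE mul_trA23E0 noiseE Qi0 /rho => ?; lra.
have FC i j : noise_form mass b U i j = noise_form mass b U j i.
  by rewrite -!noiseE -[in LHS]tr_noise mxE.
have rho_gt0 i : 0 < rho alpha lam (rshift 1 i).
  by rewrite addr_gt0 // mulr_gt0 // exprn_gt0.
have chi_gt0 i j : 0 < chi alpha lam (rshift 1 i) (rshift 1 j).
  rewrite ltr_wpDl ?sqr_ge0 // mulr_gt0 ?addr_gt0 //.
  by rewrite mulr_gt0 // exprn_gt0.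
(* Compare [Qij] with its copy under exchange of [i] and [j]: [Q] and [G] are symmetric, while [S]
   changes sign. *)
have SE i j : S i (rshift 1 j)
    = (lam 0 (rshift 1 i) - lam 0 (rshift 1 j)) * G i j / (2 * alpha).
  have := QC (rshift 1 i) (rshift 1 j); rewrite !Qij GC SC => QE.
  by apply: (canRL (mulfK _)); [rewrite gt_eqF // mulr_gt0 | lra].
have Fij i j : noise_form mass b U (rshift 1 i) (rshift 1 j)
    = chi alpha lam (rshift 1 i) (rshift 1 j) * G i j / (2 * alpha).
  move: (e22 (rshift 1 i) (rshift 1 j)).
  rewrite !mxDE A23_mulE mul_trA23E noiseE [S^T _ _]mxE (SC i j) Qij => FE.
  have -> : noise_form mass b U (rshift 1 i) (rshift 1 j)
      = (lam 0 (rshift 1 i) - lam 0 (rshift 1 j)) * S i (rshift 1 j)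
        + 2 * alpha * (lam 0 (rshift 1 j) * G i j + alpha * S i (rshift 1 j)).
    by lra.
  by rewrite SE /chi; field; rewrite gt_eqF.
split=> [i|i j|i j||i j].
- by rewrite Fi0 mulKf // gt_eqF.
- by rewrite SE Fij; field; rewrite !gt_eqF.
- by rewrite Fij; field; rewrite !gt_eqF.
- by rewrite F00; field; rewrite gt_eqF.
(* Since [lambda_1 = 0], [chi_i1 = lambda_i rho_i]; the factor [lambda_i] cancels and leaves
   [alpha / rho_i]. *)
have Q0E k : Q (rshift 1 k) ord0 = alpha * (lam 0 (rshift 1 k) + lam 0 ord0)
    / chi alpha lam (rshift 1 k) ord0 * noise_form mass b U (rshift 1 k) ord0.
  rewrite Qi0 Fi0 /chi /rho lam0 subr0 addr0; field.
  rewrite gt_eqF // (_ : _ + _ = lam 0 (rshift 1 k) * rho alpha lam (rshift 1 k)).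
    by rewrite mulr_gt0.
  by rewrite /rho; ring.
have chiC k l : chi alpha lam k l = chi alpha lam l k by rewrite /chi; ring.
(* The pair of first indices, where [chi] is 0, is excluded by hypothesis; the two mixed cases are
   [Q0E] and its transpose. *)
case: (split_ordP i) => k ->; case: (split_ordP j) => l ->;
  rewrite ?(ord1 k) ?(ord1 l) -?ord0E => neq_ij.
- by case: neq_ij.
- by rewrite QC Q0E chiC FC [lam 0 _ + _]addrC.
- exact: Q0E.
- by rewrite Qij SE Fij; field; rewrite !gt_eqF.
Qed.

End PowerSystem.

(** * Block form of the output variance, and assembly *)

Theorem theorem4p2 (R : rcfType) (p m : nat) (n_ge2 : (2 <= 1 + p)%N)
  (e : rel 'I_(1 + p)) (w : 'M[R]_(1 + p)) (src tgt : 'I_m -> 'I_(1 + p))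
  (mass d b lam : 'rV[R]_(1 + p)) (U : 'M[R]_(1 + p))
  (Qx : 'M[R]_(p + (1 + p)))
  (graph_e : simple_connected_graph e)
  (weights_w : line_weights e w)
  (lines_e : oriented_lines e src tgt)
  (mass_gt0 : forall i, 0 < mass 0 i)
  (d_gt0 : forall i, 0 < d 0 i)
  (b_gt0 : forall i, 0 < b 0 i)
  (spectral_U : spectral_data mass (laplacian w) U lam)
  (lyapunov_Qx : lyapunov_solution (A2 mass d U lam) (B2 mass b U) Qx) :
  let Ct : 'M[R]_(1 + p, m) := incidence R src tgt in
  let Mh : 'M[R]_(1 + p) := diag_invsqrt mass in
  let G : 'M[R]_p := ulsubmx Qx in
  let S : 'M[R]_(p, 1 + p) := ursubmx Qx in
  let Rm : 'M[R]_(1 + p) := drsubmx Qx in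
  let Qy : 'M[R]_(m + (1 + p)) := output_variance mass U Ct Qx in
  let Qdelta : 'M[R]_m := ulsubmx Qy in
  let Qdeltaomega : 'M[R]_(1 + p, m) := dlsubmx Qy in
  let Qomega : 'M[R]_(1 + p) := drsubmx Qy in
  [/\ Qx = block_mx G S S^T Rm, G = G^T & Rm = Rm^T] /\
  [/\ Qy = block_mx Qdelta Qdeltaomega^T Qdeltaomega Qomega,
      Qdelta = Ct^T *m Mh *m Uhat U *m G *m (Uhat U)^T *m Mh *m Ct,
      Qomega = Mh *m U *m Rm *m U^T *m Mh
    & Qdeltaomega = Mh *m U *m S^T *m (Uhat U)^T *m Mh *m Ct] /\
  (forall alpha : R, 0 < alpha -> (forall i, d 0 i / mass 0 i = alpha) ->
    [/\ forall i : 'I_p,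
          S i ord0 = (rho alpha lam (rshift 1 i))^-1
                     * noise_form mass b U (rshift 1 i) ord0,
        forall i j : 'I_p,
          S i (rshift 1 j) =
            (lam 0 (rshift 1 i) - lam 0 (rshift 1 j))
              / chi alpha lam (rshift 1 i) (rshift 1 j)
            * noise_form mass b U (rshift 1 i) (rshift 1 j),
        forall i j : 'I_p,
          G i j = 2 * alpha / chi alpha lam (rshift 1 i) (rshift 1 j)
                  * noise_form mass b U (rshift 1 i) (rshift 1 j),
        Rm ord0 ord0 = 1 / (2 * alpha) * noise_form mass b U ord0 ord0
      & forall i j : 'I_(1 + p), (i, j) <> (ord0, ord0) ->
          Rm i j = alpha * (lam 0 i + lam 0 j) / chi alpha lam i j
                   * noise_form mass b U i j]).
Proof.
move=> Ct Mh G S Rm Qy Qdelta Qdeltaomega Qomega.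
have [UTU _ lam0 lam_gt0 _] := spectral_U.
have QxT := lyapunov_A2_sym mass_gt0 d_gt0 UTU lam_gt0 lyapunov_Qx.
have GT : G^T = G by rewrite /G trmx_ulsub QxT.
have RmT : Rm^T = Rm by rewrite /Rm trmx_drsub QxT.
have ST : S^T = dlsubmx Qx by rewrite /S trmx_ursub QxT.
have QxE : Qx = block_mx G S S^T Rm by rewrite ST submxK.
have MhT : Mh^T = Mh by rewrite tr_diag_mx.
(* Needed to identify the upper right block of [Qy] with [Qdeltaomega^T]. *)
have QyT : Qy^T = Qy by rewrite /Qy /output_variance !trmx_mul trmxK QxT mulmxA.
have QyE : Qy = block_mx (Ct^T *m Mh *m Uhat U *m G *m (Uhat U)^T *m Mh *m Ct)
    (Ct^T *m Mh *m Uhat U *m S *m U^T *m Mh)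
    (Mh *m U *m S^T *m (Uhat U)^T *m Mh *m Ct) (Mh *m U *m Rm *m U^T *m Mh).
  rewrite /Qy /output_variance QxE /C2 -/Mh tr_block_mx !mulmx_block !trmx0.
  rewrite !mul0mx !mulmx0 !addr0 !add0r.
  by rewrite !trmx_mul !trmxK MhT !mulmxA.
split; first by split.
split.
  split; last by rewrite /Qdeltaomega QyE block_mxKdl.
  - by rewrite -[LHS]submxK /Qdeltaomega trmx_dlsub QyT.
  - by rewrite /Qdelta QyE block_mxKul.
  - by rewrite /Qomega QyE block_mxKdr.
move=> alpha alpha_gt0 dE; rewrite QxE in lyapunov_Qx.
exact: (lyapunov_A2_uniform mass_gt0 UTU lam_gt0 lam0).
Qed.
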